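(* Let $n\ge1$, $T>0$, $k\in\mathbb{R}$, $\theta\ge0$, $b:\mathbb{R}^n\to\mathbb{R}^n$, $h:\mathbb{R}^n\to\mathbb{R}$. Suppose that $\Sigma,A:\mathbb{R}^n\to\mathbb{R}^{n\times n}$ are symmetric-matrix valued with Lipschitz continuous and bounded coefficients, and that there are $\varepsilon>0$, $\mu\in(0,1)$ such that $z^{*}\Sigma(x)z\ge\varepsilon|z|^2$ and $z^{*}[\mu\Sigma(x)+A(x)]z\ge\varepsilon|z|^2$ for all $x,z\in\mathbb{R}^n$. Put $$\psi:=\frac1{1-\mu},\qquad B_\psi(x):=\psi A(x)+(\psi-1)\Sigma(x)=\frac1{1-\mu}[A(x)+\mu\Sigma(x)],\qquad \xi:=\frac1\psi[k+\psi-1]=1+\frac{k-1}{\psi}.$$ Suppose that the positive function $G$ is a classical solution to $$G_t+\tfrac12\mathrm{Tr}(\Sigma(x)D_x^2G)+\tfrac12\tfrac1G D_x^{*}G\,B_\psi(x)\,D_xG+b^{*}(x)D_xG+\tfrac{\theta}{\psi}(1-k)G^k+\tfrac{h(x)}{\psi}G=0,\quad (x,t)\in\mathbb{R}^n\times[0,T).$$ Then $H=G^\psi$ is a solution to $$H_t+\tfrac12\mathrm{Tr}(\Sigma(x)D_x^2H)+\tfrac12\tfrac1H D_x^{*}H\,A(x)\,D_xH+b^{*}(x)D_xH+\theta(1-k)H^{\xi}+h(x)H=0,\quad (x,t)\in\mathbb{R}^n\times[0,T),$$ where, if $\xi\ne1$, $\theta(1-k)H^\xi=\theta\frac{1-k}{1-\xi}(1-\xi)H^{\xi}$.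 Moreover: (1) $\xi>1$ if and only if $k>1$; (2) $\xi<0$ implies $k<0$; (3) every value $\xi\in[0,1)$ can be obtained with some $k<0$ by taking $\psi$ sufficiently large ($\mu$ sufficiently close to $1$): for $\psi$ sufficiently large, the number $k$ determined by $\xi=1+\frac{k-1}{\psi}$ satisfies $k<0$; (4) if $\xi=1$ (equivalently $k=1$), the power term vanishes, so the equation coincides with the one for $\theta=0$.
   Context: Vectors are column matrices and ${}^{*}$ denotes transpose. $G=G(x,t)$; $G_t$ is the time derivative, $D_xG$ is the gradient (column vector) in $x$, $D_x^{*}G=(D_xG)^{*}$, and $D_x^2G$ is the Hessian matrix in $x$. A classical solution is a function of class $\mathcal{C}^{2,1}$ (twice continuously differentiable in $x$, once in $t$) on $\mathbb{R}^n\times[0,T)$ satisfying the equation pointwise. *)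

(* Defs.v *)
From HB Require Import structures.
From mathcomp Require Import all_boot all_order all_algebra.
From mathcomp Require Import all_classical all_reals all_analysis.
Set Implicit Arguments.
Unset Strict Implicit.
Unset Printing Implicit Defensive.
Import Order.TTheory GRing.Theory Num.Theory.
Import numFieldNormedType.Exports.
Local Open Scope classical_set_scope.
Local Open Scope ring_scope.

Section Parabolic.
Context {R : realType} {n : nat}.
Implicit Types (u : 'cV[R]_n -> R -> R) (x : 'cV[R]_n) (t : R).

(* The library norm on 'cV[R]_n is the sup norm, so the Euclidean |z|^2 is
   written dotv z z; Lipschitz continuity below uses the library norm, which
   changes the Lipschitz constant only. *)
Definition dotv (v w : 'cV[R]_n) : R := (v^T *m w) 0 0.

Definition quad (v : 'cV[R]_n) (M : 'M[R]_n) (w : 'cV[R]_n) : R :=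
  (v^T *m M *m w) 0 0.

Definition space_time (T : R) : set ('cV[R]_n * R) :=
  [set p | 0 <= p.2 < T].

(* The difference quotient in time is taken within [0, T): at t = 0 the time
   derivative is the right derivative, and the values of u outside
   R^n x [0, T) are never used. *)
Definition time_quotient u x t (s : R) : R := (s - t)^-1 * (u x s - u x t).

Definition time_derivable (T : R) u x t : Prop :=
  cvg (time_quotient u x t @ within [set s | 0 <= s < T] t^').

Definition time_derive (T : R) u x t : R :=
  lim (time_quotient u x t @ within [set s | 0 <= s < T] t^').

Definition partial (i : 'I_n) u x t : R :=
  'D_(delta_mx i 0) (fun y => u y t) x.

Definition partially_derivable (i : 'I_n) u x t : Prop :=
  derivable (fun y => u y t) x (delta_mx i 0).

Definition gradient u x t : 'cV[R]_n := \col_i partial i u x t.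

Definition hessian u x t : 'M[R]_n :=
  \matrix_(i, j) partial i (partial j u) x t.

Definition continuous_on_space_time (T : R) u : Prop :=
  {within space_time T, continuous (fun p => u p.1 p.2)}.

Definition C21 (T : R) u : Prop :=
  [/\ continuous_on_space_time T u,
      forall x t, 0 <= t < T -> time_derivable T u x t,
      forall i x t, 0 <= t < T -> partially_derivable i u x t,
      forall i j x t, 0 <= t < T -> partially_derivable i (partial j u) x t &
      [/\ continuous_on_space_time T (time_derive T u),
          forall i, continuous_on_space_time T (partial i u) &
          forall i j, continuous_on_space_time T (partial i (partial j u))]].

(* u_t + 1/2 Tr(S D^2 u) + 1/2 (1/u) D*u M Du + b* Du + c u^p + q u *)
Definition pde_lhs (T : R) (S M : 'cV[R]_n -> 'M[R]_n)
    (b : 'cV[R]_n -> 'cV[R]_n) (c p : R) (q : 'cV[R]_n -> R) u x t : R :=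
  time_derive T u x t
  + 1 / 2 * \tr (S x *m hessian u x t)
  + 1 / 2 * (1 / u x t) * quad (gradient u x t) (M x) (gradient u x t)
  + dotv (b x) (gradient u x t)
  + c * (u x t) `^ p
  + q x * u x t.

(* The terms 1/u and u^p, with p an arbitrary real, only make sense for u > 0;
   positivity is therefore part of being a solution. *)
Definition positive_classical_solution (T : R) (S M : 'cV[R]_n -> 'M[R]_n)
    (b : 'cV[R]_n -> 'cV[R]_n) (c p : R) (q : 'cV[R]_n -> R) u : Prop :=
  [/\ forall x t, 0 <= t < T -> 0 < u x t,
      C21 T u &
      forall x t, 0 <= t < T -> pde_lhs T S M b c p q u x t = 0].

Definition lipschitz_bounded_coef (S : 'cV[R]_n -> 'M[R]_n) : Prop :=
  forall i j, lipschitz (fun x => S x i j) /\ bounded_fun (fun x => S x i j).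

End Parabolic.

(* Main.v *)
(** Writing w := psi * G^(psi-1), the chain rule gives H_t = w G_t,
DH = w DG and D^2 H = w D^2 G + w (psi-1)/G * DG D*G.  The trace against Sigma
of the last rank-one term is w (psi-1)/G * D*G Sigma DG, and
(1/H) D*H A DH = w psi/G * D*G A DG; together they make up the B_psi term.
As H^xi = G^(k+psi-1), the equation for H is w times the equation for G. *)
Require Import Defs.
From HB Require Import structures.
From mathcomp Require Import all_boot all_order all_algebra.
From mathcomp Require Import all_classical all_reals all_analysis.
From mathcomp Require Import ring lra.
Set Implicit Arguments.
Unset Strict Implicit.
Unset Printing Implicit Defensive.
Import Order.TTheory GRing.Theory Num.Theory.
Import numFieldNormedType.Exports.
Local Open Scope classical_set_scope.
Local Open Scope ring_scope.

(** * Chain rule for one-sided time quotients and directional derivatives *)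

(* Carathéodory's form of the chain rule.  It is stated for difference quotients
   along an arbitrary filter so as to cover both the one-sided time derivative
   within [0, T) and the directional derivatives in space. *)
Lemma cvg_quotient_comp (R : realType) (I : Type) (F : set_system I)
    {FF : Filter F} (q y : I -> R) (P : R -> R) (g d d' : R) :
  is_derive g 1 P d' -> y @ F --> g -> q s * (y s - g) @[s --> F] --> d ->
  q s * (P (y s) - P g) @[s --> F] --> d' * d.
Proof.
move=> Pd yg qd.
(* Filling in [d'] at 0 makes the slope continuous there, and the factorization below survives where
   [y s = g], since both sides then vanish. *)
pose slope (e : R) := if e == 0 then d' else e^-1 * (P (e + g) - P g).
have slope0 : {for 0, continuous slope}.
  apply/continuous_withinNx; rewrite {2}/slope eqxx.
  have := @ex_derive _ _ _ _ _ _ _ Pd; rewrite /derivable => /cvgP Pg.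
  have -> : d' = 'D_1 P g by rewrite derive_val.
  apply: cvg_trans (Pg); apply: near_eq_cvg.
  near=> e; rewrite /slope ifF; last first.
    by apply/negbTE; near: e; exact: nbhs_dnbhs_neq.
  by rewrite /= -[e *: 1]/(e * 1) mulr1.
have -> : (fun s => q s * (P (y s) - P g))
    = (fun s => slope (y s - g) * (q s * (y s - g))).
  apply/funext => s; rewrite /slope; case: ifPn => [|e0].
    by rewrite subr_eq0 => /eqP ->; rewrite !subrr !mulr0.
  by rewrite subrK; field.
apply: cvgM => //.
have -> : d' = slope 0 by rewrite /slope eqxx.
apply: continuous_cvg => //.
by rewrite -[0](subrr g); apply: cvgB => //; exact: cvg_cst.
Unshelve. all: by end_near. Qed.

(** Since [t < T], points just to the right of [t] stay in [0, T), even for [t = 0]. Properness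
    makes limits along this filter unique, so that [lim] can be computed. *)
Lemma within_dnbhs_proper (R : realType) (T : R) (t : R) :
  0 <= t < T -> ProperFilter (within [set s | 0 <= s < T] t^').
Proof.
move=> /andP[t0 tT]; split; last exact: within_filter.
rewrite /within /= /prop_near1 => Ft.
have : \forall s \near t^'+, False.
  near=> s.
  have : s != t -> 0 <= s < T -> False by near: s; apply: cvg_within; exact: Ft.
  apply.
    by rewrite gt_eqF//; near: s; exact: nbhs_right_gt.
  apply/andP; split; last by near: s; exact: nbhs_right_lt.
  by apply: le_trans t0 _; apply/ltW; near: s; exact: nbhs_right_gt.
exact: filter_not_empty.
Unshelve. all: by end_near. Qed.

(** Knowing [v] on [0, T) suffices: the time quotient only samples [s] in that interval and [t]
    itself. *)
Lemma time_derive_comp (R : realType) (n : nat) (T : R) (P : R -> R) (d' : R)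
    (u v : 'cV[R]_n -> R -> R) (x : 'cV[R]_n) (t : R) :
  (forall s : R, 0 <= s < T -> v x s = P (u x s)) -> 0 <= t < T ->
  is_derive (u x t) 1 P d' -> time_derivable T u x t ->
  time_derivable T v x t /\ time_derive T v x t = d' * time_derive T u x t.
Proof.
move=> vE tT Pd; rewrite /time_derivable /time_derive.
have FF := within_dnbhs_proper tT.
have Fneq : \forall s \near within [set s | 0 <= s < T] t^', s != t.
  by apply: cvg_within; near=> s; near: s; exact: nbhs_dnbhs_neq.
have FT : \forall s \near within [set s | 0 <= s < T] t^', 0 <= s < T.
  exact: withinT.
have tF : (fun s : R => s) @ within [set s | 0 <= s < T] t^' --> t.
  by apply: cvg_trans (@nbhs_dnbhs _ t); exact: cvg_within.
(* From here the filter matters only through four facts: it is proper, avoids [t], stays in [0, T)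
   and tends to [t]. *)
move: (within _ _) FF Fneq FT tF => F FF Fneq FT tF qF.
(* Continuity in time follows from convergence of the quotient, as the increment is [s - t] times
   the quotient. *)
have uF : u x @ F --> u x t.
  have : (s - t) * time_quotient u x t s + u x t @[s --> F]
      --> (t - t) * lim (time_quotient u x t @ F) + u x t.
    apply: cvgD; last exact: cvg_cst.
    by apply: cvgM => //; apply: cvgB => //; exact: cvg_cst.
  rewrite subrr mul0r add0r; apply: cvg_trans; apply: near_eq_cvg.
  near=> s; rewrite /time_quotient mulrA divff ?mul1r ?subrK// subr_eq0.
  by near: s.
have vF : time_quotient v x t @ F --> d' * lim (time_quotient u x t @ F).
  have := cvg_quotient_comp (q := fun s => (s - t)^-1) Pd uF qF => qvF.
  apply: cvg_trans; last exact: qvF.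
  apply: near_eq_cvg.
  by near=> s; rewrite /time_quotient !vE//; near: s.
by split; [apply/cvg_ex; eexists; exact: vF | exact: cvg_lim vF].
Unshelve. all: by end_near. Qed.

(** Only the line through [x] in direction [v] is involved, so derivability along [v] is enough: it
    gives continuity along that line, and the quotient lemma applies with factor [h^-1]. *)
Lemma is_derive_comp_along (R : realType) (V : normedModType R)
    (P : R -> R) (d' : R) (f : V -> R) (x v : V) :
  is_derive (f x) 1 P d' -> derivable f x v ->
  is_derive x v (P \o f) (d' * 'D_v f x).
Proof.
move=> Pd fx.
have fF : (fun h : R => f (h *: v + x)) @ 0^' --> f x.
  have : h * (h^-1 * (f (h *: v + x) - f x)) + f x @[h --> 0^']
      --> 0 * 'D_v f x + f x.
    apply: cvgD; last exact: cvg_cst.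
    by apply: cvgM; [exact: nbhs_dnbhs | exact: fx].
  rewrite mul0r add0r; apply: cvg_trans; apply: near_eq_cvg.
  near=> h; rewrite mulrA divff ?mul1r ?subrK//.
  by near: h; exact: nbhs_dnbhs_neq.
have vF : h^-1 * (P (f (h *: v + x)) - P (f x)) @[h --> 0^'] --> d' * 'D_v f x.
  exact: (cvg_quotient_comp (q := fun h => h^-1) Pd fF fx).
split; first by apply/cvg_ex; eexists; exact: vF.
exact: cvg_lim vF.
Unshelve. all: by end_near. Qed.

(** * Time and space derivatives of a power *)

Lemma time_derive_powR (R : realType) (n : nat) (T a : R)
    (u v : 'cV[R]_n -> R -> R) (x : 'cV[R]_n) (t : R) :
  (forall s : R, 0 <= s < T -> v x s = u x s `^ a) -> 0 <= t < T ->
  0 < u x t -> time_derivable T u x t ->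
  time_derivable T v x t /\
  time_derive T v x t = a * u x t `^ (a - 1) * time_derive T u x t.
Proof.
move=> vE tT u0; apply: (time_derive_comp (P := @powR R ^~ a)) => //.
exact: is_derive1_powR.
Qed.

Lemma is_derive_powR_along (R : realType) (V : normedModType R) (a : R)
    (f : V -> R) (x v : V) :
  0 < f x -> derivable f x v ->
  is_derive x v (fun y => f y `^ a) (a * f x `^ (a - 1) * 'D_v f x).
Proof.
move=> f0; apply: (is_derive_comp_along (P := @powR R ^~ a)).
exact: is_derive1_powR.
Qed.

Lemma partial_powR (R : realType) (n : nat) (a t : R)
    (u v : 'cV[R]_n -> R -> R) (i : 'I_n) (x : 'cV[R]_n) :
  (forall y, v y t = u y t `^ a) -> 0 < u x t -> partially_derivable i u x t ->
  partially_derivable i v x t /\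
  partial i v x t = a * u x t `^ (a - 1) * partial i u x t.
Proof.
move=> vE u0 ux.
have vD := is_derive_powR_along a u0 ux.
have -> : partial i v x t = 'D_(delta_mx i 0) (fun y => u y t `^ a) x.
  by rewrite -(funext vE).
rewrite /partially_derivable (funext vE).
by split; [exact: ex_derive | rewrite derive_val].
Qed.

Lemma partial2_powR (R : realType) (n : nat) (a t : R)
    (u v : 'cV[R]_n -> R -> R) (i j : 'I_n) (x : 'cV[R]_n) :
  (forall y, v y t = u y t `^ a) -> (forall y, 0 < u y t) ->
  (forall l y, partially_derivable l u y t) ->
  partially_derivable i (partial j u) x t ->
  partially_derivable i (partial j v) x t /\
  partial i (partial j v) x t =
    a * u x t `^ (a - 1) * partial i (partial j u) x t
    + a * (a - 1) * u x t `^ (a - 2) * (partial i u x t * partial j u x t).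
Proof.
move=> vE u0 uD uDD.
(* The outer derivative needs the first-order formula at all [y], not just at [x]; the product rule
   then applies. *)
have pvE : (fun y => partial j v y t)
    = (fun y => a * (u y t `^ (a - 1) * partial j u y t)).
  by apply/funext => y; rewrite (partial_powR vE (u0 y) (uD j y)).2 mulrA.
have wD := is_derive_powR_along (a - 1) (u0 x) (uD i x).
have pD : is_derive x (delta_mx i 0) (fun y => partial j u y t)
    (partial i (partial j u) x t) := derivableP uDD.
have mD := is_deriveM wD pD.
have [fD fE] := is_deriveZ a mD.
rewrite /partially_derivable [partial i (partial j v) x t]/partial pvE.
split; first exact: fD.
rewrite [LHS]fE -![_ *: _]/(_ * _) -/(partial i u x t).
have -> : a - 1 - 1 = a - 2 by ring.
ring.
Qed.

(** * Regularity of a power on space-time *)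

Lemma continuous_on_space_time_powR (R : realType) (n : nat) (T a : R)
    (u : 'cV[R]_n -> R -> R) :
  (forall x (t : R), 0 <= t < T -> 0 < u x t) -> continuous_on_space_time T u ->
  continuous_on_space_time T (fun x t => u x t `^ a).
Proof.
move=> u0 /subspace_continuousP uc; apply/subspace_continuousP => -[x t] tT.
have [pD _] := is_derive1_powR a (u0 x t tT).
(* Positivity of [u x t] gives derivability of the power there, hence continuity for every real
   exponent, negative ones included. *)
have powc : {for u x t, continuous (@powR R ^~ a)}.
  exact/differentiable_continuous/derivable1_diffP.
exact: (continuous_cvg _ powc (uc (x, t) tT)).
Qed.

Lemma continuous_on_space_timeM (R : realType) (n : nat) (T : R)
    (u v : 'cV[R]_n -> R -> R) :
  continuous_on_space_time T u -> continuous_on_space_time T v ->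
  continuous_on_space_time T (fun x t => u x t * v x t).
Proof. by move=> uc vc p; apply: cvgM; [exact: uc | exact: vc]. Qed.

Lemma continuous_on_space_timeD (R : realType) (n : nat) (T : R)
    (u v : 'cV[R]_n -> R -> R) :
  continuous_on_space_time T u -> continuous_on_space_time T v ->
  continuous_on_space_time T (fun x t => u x t + v x t).
Proof. by move=> uc vc p; apply: cvgD; [exact: uc | exact: vc]. Qed.

Lemma continuous_on_space_time_cst (R : realType) (n : nat) (T c : R) :
  continuous_on_space_time T (fun (_ : 'cV[R]_n) (_ : R) => c).
Proof. by move=> p; exact: cvg_cst. Qed.

Lemma eq_continuous_on_space_time (R : realType) (n : nat) (T : R)
    (u v : 'cV[R]_n -> R -> R) :
  (forall x (t : R), 0 <= t < T -> u x t = v x t) ->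
  continuous_on_space_time T u -> continuous_on_space_time T v.
Proof.
move=> uv; apply: subspace_eq_continuous => -[x t].
by rewrite inE; exact: uv.
Qed.

(** On [0, T) each derivative of [v] is a sum of products of constants, powers of [u] and
    derivatives of [u], all continuous. *)
Lemma C21_powR (R : realType) (n : nat) (T a : R) (u v : 'cV[R]_n -> R -> R) :
  (forall x (t : R), 0 <= t < T -> 0 < u x t) ->
  (forall x (t : R), 0 <= t < T -> v x t = u x t `^ a) -> C21 T u -> C21 T v.
Proof.
move=> u0 vE [uc ut ux uxx [utc uxc uxxc]].
have powc e : continuous_on_space_time T (fun x t => u x t `^ e).
  exact: continuous_on_space_time_powR.
have cstc c := @continuous_on_space_time_cst R n T c.
have vt x (t : R) (tT : 0 <= t < T) :=
  time_derive_powR (vE x) tT (u0 x t tT) (ut x t tT).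
have vx i x (t : R) (tT : 0 <= t < T) :=
  partial_powR (fun y => vE y t tT) (u0 x t tT) (ux i x t tT).
have vxx i j x (t : R) (tT : 0 <= t < T) :=
  partial2_powR (fun y => vE y t tT) (fun y => u0 y t tT)
    (fun l y => ux l y t tT) (uxx i j x t tT).
split.
- by apply: eq_continuous_on_space_time (powc a) => x t tT; rewrite vE.
- by move=> x t tT; case: (vt x t tT).
- by move=> i x t tT; case: (vx i x t tT).
- by move=> i j x t tT; case: (vxx i j x t tT).
split.
- apply: (@eq_continuous_on_space_time _ _ _
    (fun x t => a * u x t `^ (a - 1) * time_derive T u x t)).
    by move=> x t tT; rewrite (vt x t tT).2.
  by apply: continuous_on_space_timeM utc; exact: continuous_on_space_timeM.
- move=> i; apply: (@eq_continuous_on_space_time _ _ _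
    (fun x t => a * u x t `^ (a - 1) * partial i u x t)).
    by move=> x t tT; rewrite (vx i x t tT).2.
  by apply: continuous_on_space_timeM (uxc i); exact: continuous_on_space_timeM.
- move=> i j; apply: (@eq_continuous_on_space_time _ _ _
    (fun x t => a * u x t `^ (a - 1) * partial i (partial j u) x t
       + a * (a - 1) * u x t `^ (a - 2) * (partial i u x t * partial j u x t))).
    by move=> x t tT; rewrite (vxx i j x t tT).2.
  apply: continuous_on_space_timeD.
    apply: continuous_on_space_timeM (uxxc i j).
    exact: (continuous_on_space_timeM (cstc a)).
  apply: continuous_on_space_timeM.
    exact: (continuous_on_space_timeM (cstc _)).
  exact: (continuous_on_space_timeM (uxc i) (uxc j)).
Qed.

(** * Quadratic forms and the transformation of the equation *)

Lemma tr_mul_outer (R : realType) (n : nat) (S : 'M[R]_n) (g : 'cV[R]_n) :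
  \tr (S *m (g *m g^T)) = quad g S g.
Proof. by rewrite mulmxA mxtrace_mulC trace_mx11 mulmxA. Qed.

Lemma quadZ (R : realType) (n : nat) (M : 'M[R]_n) (c : R) (g : 'cV[R]_n) :
  quad (c *: g) M (c *: g) = c ^+ 2 * quad g M g.
Proof.
have -> : quad (c *: g) M (c *: g) = ((c *: g^T) *m M *m (c *: g)) 0 0.
  by rewrite -linearZ.
by rewrite -!scalemxAl -scalemxAr !scalerA [LHS]mxE -expr2.
Qed.

Lemma quad_comb (R : realType) (n : nat) (M N : 'M[R]_n) (c d : R)
    (g : 'cV[R]_n) :
  quad g (c *: M + d *: N) g = c * quad g M g + d * quad g N g.
Proof.
rewrite /quad mulmxDr mulmxDl -!scalemxAr -!scalemxAl.
by rewrite [LHS]mxE; congr (_ + _); rewrite [LHS]mxE.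
Qed.

(** The factor [a * u^(a-1)] comes out of every term. The coefficients [c] and [q] are divided by
    [a] because the zero-order terms are not differentiated and yield no factor [a] of their own. *)
Lemma pde_lhs_powR (R : realType) (n : nat) (T a k c : R)
    (S M : 'cV[R]_n -> 'M[R]_n) (b : 'cV[R]_n -> 'cV[R]_n) (q : 'cV[R]_n -> R)
    (u v : 'cV[R]_n -> R -> R) (x : 'cV[R]_n) (t : R) :
  a != 0 -> 0 <= t < T ->
  (forall x (t : R), 0 <= t < T -> 0 < u x t) ->
  (forall x (t : R), 0 <= t < T -> v x t = u x t `^ a) -> C21 T u ->
  pde_lhs T S M b c (1 / a * (k + a - 1)) q v x t =
  a * u x t `^ (a - 1) *
    pde_lhs T S (fun x => a *: M x + (a - 1) *: S x) b (c / a) k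
      (fun x => q x / a) u x t.
Proof.
move=> a0 tT u0 vE [_ ut ux uxx _].
have g0 := u0 x t tT.
have vt := (time_derive_powR (vE x) tT g0 (ut x t tT)).2.
have vx : gradient v x t = (a * u x t `^ (a - 1)) *: gradient u x t.
  apply/matrixP => i j; rewrite !mxE.
  by have [_ ->] := partial_powR (fun y => vE y t tT) g0 (ux i x t tT).
have vxx : hessian v x t = (a * u x t `^ (a - 1)) *: hessian u x t
    + (a * (a - 1) * u x t `^ (a - 2)) *:
      (gradient u x t *m (gradient u x t)^T).
  apply/matrixP => i j; rewrite !mxE big_ord1 !mxE.
  by have [_ ->] := partial2_powR (fun y => vE y t tT) (fun y => u0 y t tT)
    (fun l y => ux l y t tT) (uxx i j x t tT).
rewrite /pde_lhs vt vx vxx quadZ quad_comb (vE x t tT).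
rewrite mulmxDr -!scalemxAr mxtraceD !mxtraceZ tr_mul_outer.
rewrite /dotv -scalemxAr [(_ *: (_ *m _)) 0 0]mxE -!/(dotv _ _).
have gn0 : u x t != 0 by rewrite gt_eqF.
rewrite -powRrM (_ : a * (1 / a * (k + a - 1)) = k + (a - 1)); last by field.
have powD e f : u x t `^ (e + f) = u x t `^ e * u x t `^ f.
  by apply: powRD; rewrite gn0 implybT.
have pow1 : u x t `^ 1 = u x t by rewrite powRr1// ltW.
(* All powers are reduced to [u^(a-2)], [u^k] and natural powers of [u]; once the first two are
   abstracted, the identity is one of rational functions. *)
have -> : u x t `^ a = u x t `^ (a - 2) * u x t ^+ 2.
  by rewrite -powR_mulrn ?ltW// -powD subrK.
have -> : u x t `^ (k + (a - 1)) = u x t `^ k * (u x t `^ (a - 2) * u x t).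
  rewrite powD; congr (_ * _).
  by rewrite -[X in _ * X]pow1 -powD; congr (_ `^ _); ring.
have -> : u x t `^ (a - 1) = u x t `^ (a - 2) * u x t.
  by rewrite -[X in _ * X]pow1 -powD; congr (_ `^ _); ring.
have pn0 : u x t `^ (a - 2) != 0 by rewrite gt_eqF// powR_gt0.
move: (u x t `^ (a - 2)) pn0 (u x t `^ k) => w wn0 z.
move: (time_derive T u x t) (\tr _) (quad _ _ _) (quad _ _ _) (dotv _ _).
move: (u x t) gn0 (q x) => g gn0 qx d1 d2 d3 d4 d5.
field.
by rewrite a0 gn0 wn0.
Qed.

(** * Exponents, and the final assembly *)

(** Solving for [k] gives [1 - psi * (1 - xi)]. Existence and uniqueness keep the negativity claim
    from being vacuous. *)
Lemma exponent_neg (R : realType) (xi psi : R) :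
  0 < psi -> 1 < psi * (1 - xi) ->
  (exists! k : R, xi = 1 + (k - 1) / psi) /\
  (forall k : R, xi = 1 + (k - 1) / psi -> k < 0).
Proof.
move=> psi0 psi1; have psiN0 : psi != 0 by rewrite gt_eqF.
have kE k : xi = 1 + (k - 1) / psi -> k = 1 - psi * (1 - xi).
  by move=> ->; field.
split; last by move=> k /kE ->; rewrite subr_lt0.
by exists (1 - psi * (1 - xi)); split=> [|k /kE -> //]; field.
Qed.

Theorem lemma2p1 (R : realType) (n : nat) (hn : (1 <= n)%N)
  (T k theta : R) (hT : 0 < T) (htheta : 0 <= theta)
  (b : 'cV[R]_n -> 'cV[R]_n) (h : 'cV[R]_n -> R)
  (Sigma A : 'cV[R]_n -> 'M[R]_n)
  (Sigma_sym : forall x, (Sigma x)^T = Sigma x)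
  (A_sym : forall x, (A x)^T = A x)
  (Sigma_coef : lipschitz_bounded_coef Sigma)
  (A_coef : lipschitz_bounded_coef A)
  (eps mu : R) (heps : 0 < eps) (hmu : 0 < mu < 1)
  (Sigma_ell : forall x z, eps * dotv z z <= quad z (Sigma x) z)
  (SigmaA_ell : forall x z, eps * dotv z z <= quad z (mu *: Sigma x + A x) z)
  (psi xi : R) (B : 'cV[R]_n -> 'M[R]_n)
  (psiE : psi = 1 / (1 - mu))
  (BE : forall x, B x = psi *: A x + (psi - 1) *: Sigma x)
  (xiE : xi = 1 / psi * (k + psi - 1))
  (G : 'cV[R]_n -> R -> R)
  (G_sol : positive_classical_solution T Sigma B b
             (theta / psi * (1 - k)) k (fun x => h x / psi) G)
  (H : 'cV[R]_n -> R -> R)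
  (HE : forall x t, 0 <= t < T -> H x t = (G x t) `^ psi) :
  ((forall x, B x = (1 / (1 - mu)) *: (A x + mu *: Sigma x)) /\
   xi = 1 + (k - 1) / psi) /\
  positive_classical_solution T Sigma A b (theta * (1 - k)) xi h H /\
  (xi <> 1 -> forall x t, 0 <= t < T ->
     theta * (1 - k) * (H x t) `^ xi
     = theta * ((1 - k) / (1 - xi)) * (1 - xi) * (H x t) `^ xi) /\
  (* (1) *)
  (1 < xi <-> 1 < k) /\
  (* (2) *)
  (xi < 0 -> k < 0) /\
  (* (3), for psi large and for mu close to 1 *)
  (forall xi' : R, 0 <= xi' < 1 ->
     (\forall psi' \near +oo,
        (exists! k' : R, xi' = 1 + (k' - 1) / psi') /\
        (forall k' : R, xi' = 1 + (k' - 1) / psi' -> k' < 0)) /\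
     (\forall mu' \near 1^'-,
        (exists! k' : R, xi' = 1 + (k' - 1) / (1 / (1 - mu'))) /\
        (forall k' : R, xi' = 1 + (k' - 1) / (1 / (1 - mu')) -> k' < 0))) /\
  (* (4) *)
  (xi = 1 <-> k = 1) /\
  (xi = 1 -> forall (u : 'cV[R]_n -> R -> R) x t,
     theta * (1 - k) * (u x t) `^ xi = 0 /\
     pde_lhs T Sigma A b (theta * (1 - k)) xi h u x t
     = pde_lhs T Sigma A b (0 * (1 - k)) xi h u x t).
Proof.
have /andP[mu0 mu1] := hmu.
have mu1N0 : 1 - mu != 0 by rewrite subr_eq0 gt_eqF.
have psi1 : 1 < psi by rewrite psiE ltr_pdivlMr; lra.
have psi0 : 0 < psi by apply: lt_trans psi1.
have psiN0 : psi != 0 by rewrite gt_eqF.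
have xiE' : xi = 1 + (k - 1) / psi by rewrite xiE; field.
(* This form, with [psi > 1], yields (1), (2) and one direction of (4): if [xi < 0], then
   [psi * (xi - 1) < -1]. *)
have kE : k = 1 + psi * (xi - 1) by rewrite xiE'; field.
have xi1 : xi = 1 <-> k = 1.
  by split=> [x1|k1]; [rewrite kE x1 | rewrite xiE' k1];
    rewrite subrr ?mulr0 ?mul0r addr0.
have [G0 GC Gpde] := G_sol.
have H0 x t : 0 <= t < T -> 0 < H x t by move=> tT; rewrite HE// powR_gt0// G0.
split; first split=> // x.
  by rewrite BE psiE scalerDr scalerA; congr (_ + _ *: _); field.
split.
  split; [exact: H0 | exact: C21_powR G0 HE GC |].
  move=> x t tT; rewrite xiE (pde_lhs_powR _ _ _ _ _ _ _ psiN0 tT G0 HE GC).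
  rewrite (_ : (fun x => psi *: A x + (psi - 1) *: Sigma x) = B); last first.
    by apply/funext => y; rewrite BE.
  by rewrite [theta * (1 - k) / psi]mulrAC Gpde ?mulr0.
split.
  move=> /eqP xiN1 x t tT; congr (_ * _); field.
  by rewrite subr_eq0 eq_sym.
split; first by rewrite [in X in _ <-> X]kE ltrDl pmulr_rgt0// subr_gt0.
split.
  by move=> xi0; rewrite kE; nra.
split.
  move=> xi' /andP[xi'0 xi'1]; split.
    near=> psi'.
    (* This threshold is the condition [1 < psi' * (1 - xi')] solved for [psi']. *)
    have psi'1 : 1 / (1 - xi') < psi'
      by near: psi'; apply: nbhs_pinfty_gt; exact: num_real.
    apply: exponent_neg.
      by apply: lt_trans psi'1; rewrite divr_gt0// subr_gt0.
    by rewrite -ltr_pdivrMr// subr_gt0.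
  near=> mu'.
  have mu'1 : mu' < 1 by near: mu'; exact: nbhs_left_lt.
  (* With [psi' = 1 / (1 - mu')], the same condition reads [1 - mu' < 1 - xi']. *)
  have ximu : xi' < mu' by near: mu'; exact: nbhs_left_gt.
  apply: exponent_neg; first by rewrite divr_gt0// subr_gt0.
  by rewrite mul1r mulrC ltr_pdivlMr ?subr_gt0//; lra.
split=> // /xi1 k1 u x t; rewrite k1 subrr !mulr0 mul0r.
Unshelve. all: by end_near. Qed.
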